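(* Let $\tau>0$ and let $\check E,\check A\in\mathbb{R}^{n_1\times n_1}$, $\check B\in\mathbb{R}^{n_1\times m_1}$, $\check C\in\mathbb{R}^{p_1\times n_1}$, $\hat E,\hat A\in\mathbb{R}^{n_2\times n_2}$, $\hat B\in\mathbb{R}^{n_2\times m_2}$, $\hat C\in\mathbb{R}^{p_2\times n_2}$ with $m_1=p_2$ and $m_2=p_1$. Consider the linear shifted hybrid numerical-experimental system $$\begin{bmatrix}\check E&0\\0&\hat E\end{bmatrix}\begin{bmatrix}\dot z_1(t)\\ \dot z_2(t)\end{bmatrix}=\begin{bmatrix}\check A&0\\ \hat B\check C&\hat A\end{bmatrix}\begin{bmatrix}z_1(t)\\ z_2(t)\end{bmatrix}+\begin{bmatrix}0&\check B\hat C\\0&0\end{bmatrix}\begin{bmatrix}z_1(t-\tau)\\ z_2(t-\tau)\end{bmatrix}+\begin{bmatrix}\check f(t)\\ \hat f(t)\end{bmatrix}.$$ The matrix pencil of its associated DAE, i.e. the pencil $$\left(\begin{bmatrix}\check E&0\\0&\hat E\end{bmatrix},\begin{bmatrix}\check A&0\\ \hat B\check C&\hat A\end{bmatrix}\right),$$ is regular if and only if both matrix pencils $(\check E,\check A)$ and $(\hat E,\hat A)$ of the linear subsystems $\check E\dot z_1=\check A z_1+\check B u_1+\check f$ and $\hat E\dot z_2=\hat A z_2+\hat B u_2+\hat f$ are regular.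
   Context: A matrix pencil $(E,A)\in(\mathbb{R}^{n\times n})^2$ is called regular if $\det(sE-A)\in\mathbb{R}[s]$ is not the zero polynomial. The associated DAE of a delay differential-algebraic equation (DDAE) is the differential-algebraic equation (DAE) obtained by replacing the delayed state $z(t-\tau)$ with a control function $u(t)$; the matrix pencil of a linear DAE $E\dot z=Az+Bu+f$ is $(E,A)$. The system in the claim arises from the two subsystems with outputs $y_1=\check C z_1$, $y_2=\hat C z_2$ by the coupling $u_1(t)=y_2(t-\tau)$, $u_2(t)=y_1(t)$. *)

(* Defs.v *)
From mathcomp Require Import all_boot all_order all_algebra.
From mathcomp Require Import reals.

Set Implicit Arguments.
Unset Strict Implicit.
Unset Printing Implicit Defensive.

Import Order.TTheory GRing.Theory Num.Theory.
Local Open Scope ring_scope.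

(* det (s E - A), as a polynomial in the indeterminate s = 'X, is not the
   zero polynomial. *)
Definition regular_pencil (R : realType) (n : nat)
    (P : 'M[R]_n * 'M[R]_n) : Prop :=
  \det ('X *: map_mx polyC P.1 - map_mx polyC P.2) != 0 :> {poly R}.

(* E z'(t) = A z(t) + B u(t) + f(t), with state z(t) in R^n and control u(t)
   in R^m. *)
Record linear_dae (R : realType) (n m : nat) := LinearDAE {
  dae_E : 'M[R]_n;
  dae_A : 'M[R]_n;
  dae_B : 'M[R]_(n, m);
  dae_f : R -> 'cV[R]_n }.

Definition dae_pencil (R : realType) (n m : nat) (S : linear_dae R n m) :
  'M[R]_n * 'M[R]_n := (dae_E S, dae_A S).

(* E z'(t) = A z(t) + D z(t - tau) + f(t), with state z(t) in R^n. *)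
Record linear_ddae (R : realType) (n : nat) := LinearDDAE {
  ddae_tau : R;
  ddae_E : 'M[R]_n;
  ddae_A : 'M[R]_n;
  ddae_D : 'M[R]_n;
  ddae_f : R -> 'cV[R]_n }.

(* z(t - tau) is replaced by a control u(t) in R^n, which therefore enters
   through the matrix D. *)
Definition associated_dae (R : realType) (n : nat) (S : linear_ddae R n) :
    linear_dae R n n :=
  LinearDAE (ddae_E S) (ddae_A S) (ddae_D S) (ddae_f S).

(* Main.v *)
Require Import Defs.
From mathcomp Require Import all_boot all_order all_algebra.
From mathcomp Require Import reals.

Set Implicit Arguments.
Unset Strict Implicit.
Unset Printing Implicit Defensive.

Import Order.TTheory GRing.Theory Num.Theory.
Local Open Scope ring_scope.

(** The coupling u2 = y1 acts without delay and only from the first subsystem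
    to the second, while the delayed coupling u1 = y2(t - tau) becomes a control
    and leaves the pencil.  Hence the coupled matrix s E - A is block lower
    triangular with the subsystem matrices s E1 - A1 and s E2 - A2 on its
    diagonal, and its determinant is the product of theirs
    ([det_pencil_lower_block]).  Since R[s] is an integral domain, that product
    is nonzero exactly when both factors are. *)

Lemma det_pencil_lower_block (R : comNzRingType) (n1 n2 : nat)
    (E1 A1 : 'M[R]_n1) (E2 A2 : 'M[R]_n2) (E21 A21 : 'M[R]_(n2, n1)) :
  \det ('X *: map_mx polyC (block_mx E1 0 E21 E2)
        - map_mx polyC (block_mx A1 0 A21 A2)) =
  \det ('X *: map_mx polyC E1 - map_mx polyC A1) *
  \det ('X *: map_mx polyC E2 - map_mx polyC A2) :> {poly R}.
Proof.
rewrite !map_block_mx !map_mx0 scale_block_mx opp_block_mx add_block_mx.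
by rewrite scaler0 subr0 det_lblock.
Qed.

Theorem lemma4p5 (R : realType) (n1 n2 m1 m2 : nat)
    (tau : R) (tau_gt0 : 0 < tau)
    (E1 A1 : 'M[R]_n1) (B1 : 'M[R]_(n1, m1)) (C1 : 'M[R]_(m2, n1))
    (E2 A2 : 'M[R]_n2) (B2 : 'M[R]_(n2, m2)) (C2 : 'M[R]_(m1, n2))
    (f1 : R -> 'cV[R]_n1) (f2 : R -> 'cV[R]_n2) :
  regular_pencil (dae_pencil (associated_dae
    (LinearDDAE tau
       (block_mx E1 0 0 E2)
       (block_mx A1 0 (B2 *m C1) A2)
       (block_mx 0 (B1 *m C2) 0 0)
       (fun t => col_mx (f1 t) (f2 t)))))
  <->
  regular_pencil (dae_pencil (LinearDAE E1 A1 B1 f1)) /\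
  regular_pencil (dae_pencil (LinearDAE E2 A2 B2 f2)).
Proof.
rewrite /regular_pencil /= det_pencil_lower_block mulf_eq0 negb_or.
by split=> /andP.
Qed.
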